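(* Let $\mathfrak{X}=(\Gamma,c:\Gamma^2\to\mathcal{C})$ be a configuration. Call an edge colour $c_0\in\mathcal{C}$ nonempty if for every $v\in\Gamma$ there is at most one $w\in\Gamma$ with $c(v,w)=c_0$, and empty otherwise. Let $\Gamma_{\mathfrak{X}}$ be the graph with vertex set $\Gamma$ and edge set $\{(v_1,v_2)\in\Gamma^2: c(v_1,v_2) \text{ is a nonempty edge colour}\}$, and suppose $\Gamma_{\mathfrak{X}}$ is connected. Then the number $WL(\mathfrak{X})$ of nontrivial iterations of the Weisfeiler-Leman algorithm applied to $\mathfrak{X}$ satisfies $$WL(\mathfrak{X})\leq\log_2\mathrm{diam}\,\Gamma_{\mathfrak{X}}+3 .$$
   Context: A (classical) configuration is a pair $(\Gamma,c)$ with $\Gamma$ a finite set and $c:\Gamma^2\to\mathcal{C}$ a map to a finite set of colours such that: (i) if some $c_0\in\mathcal{C}$ satisfies $c(v,v)=c_0$ for some $v$, then $c(v_1,v_2)=c_0$ implies $v_1=v_2$; (ii) for every $c_0\in\mathcal{C}$ there is $c_0^{-1}\in\mathcal{C}$ such that $c(v_1,v_2)=c_0$ implies $c(v_2,v_1)=c_0^{-1}$. Colours of the form $c(v,v)$ are vertex colours; the others are edge colours. Connectedness of $\Gamma_{\mathfrak{X}}$ is understood so that any vertex can be reached from any other by a directed path, and $\mathrm{diam}\,\Gamma_{\mathfrak{X}}$ is the maximum over ordered pairs of the length of a shortest directed path. Weisfeiler-Leman algorithm: put $c^{(0)}=c$, $\mathcal{C}^{(0)}=\mathcal{C}$, and define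 $c^{(h+1)}(v_1,v_2)$ to be the tuple consisting of $c^{(h)}(v_1,v_2)$ together with the family of numbers $\left|\{w\in\Gamma: c^{(h)}(v_1,w)=c_1,\ c^{(h)}(w,v_2)=c_2\}\right|$ indexed by $(c_1,c_2)\in\mathcal{C}^{(h)}\times\mathcal{C}^{(h)}$; $\mathcal{C}^{(h+1)}$ is the set of values of $c^{(h+1)}$. The number of nontrivial iterations $WL(\mathfrak{X})$ is the least $h\geq0$ such that the partition of $\Gamma^2$ into colour classes of $c^{(h+1)}$ equals that of $c^{(h)}$. *)

(* Defs.v *)
From mathcomp Require Import all_boot all_order all_algebra.
From mathcomp Require Import reals exp.

Set Implicit Arguments.
Unset Strict Implicit.
Unset Printing Implicit Defensive.

Import GRing.Theory.

Record configuration := Configuration {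
  vertex : finType;
  colour : finType;
  col : vertex * vertex -> colour;
  col_diag : forall c0 : colour, (exists v, col (v, v) = c0) ->
    forall v1 v2, col (v1, v2) = c0 -> v1 = v2;
  col_inv : forall c0 : colour, exists c0' : colour,
    forall v1 v2, col (v1, v2) = c0 -> col (v2, v1) = c0'
}.

Section ColourGraph.
Variable X : configuration.

Definition vertex_colour (c0 : colour X) : bool :=
  [exists v, col (v, v) == c0].

Definition edge_colour (c0 : colour X) : bool := ~~ vertex_colour c0.

(* "Nonempty" does not mean "attained": it says that the relation of colour c0
   is a partial function. *)
Definition nonempty_colour (c0 : colour X) : bool :=
  edge_colour c0 && [forall v, #|[set w | col (v, w) == c0]| <= 1].

Definition colour_graph : rel (vertex X) :=
  [rel v1 v2 | nonempty_colour (col (v1, v2))].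

End ColourGraph.

Section DirectedGraph.
Variables (T : finType) (e : rel T).

Definition strongly_connected : Prop := forall v w, connect e v w.

Definition walk_length (v w : T) (n : nat) : bool :=
  [exists p : n.-tuple T, path e v p && (last v p == w)].

Lemma connect_walk_length v w : connect e v w -> exists n, walk_length v w n.
Proof.
case/connectP => p ep ->; exists (size p).
by apply/existsP; exists (in_tuple p); rewrite ep eqxx.
Qed.

Definition dist (econ : strongly_connected) (v w : T) : nat :=
  ex_minn (connect_walk_length (econ v w)).

Definition diam (econ : strongly_connected) : nat :=
  \max_(v : T) \max_(w : T) dist econ v w.

End DirectedGraph.

Section WeisfeilerLeman.
Variable T : finType.

Record colouring := Colouring {
  palette : finType;
  paint : T * T -> palette
}.

Definition wl_tuple (c : colouring) (p : T * T) :
    palette c * {ffun palette c * palette c -> nat} :=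
  (paint c p,
   [ffun q => #|[set w | (paint c (p.1, w) == q.1)
                      && (paint c (w, p.2) == q.2)]|]).

(* The new palette is exactly the set of values of wl_tuple. *)
Definition wl_step (c : colouring) : colouring :=
  @Colouring (seq_sub (codom (wl_tuple c)))
    (fun p => SeqSub (codom_f (wl_tuple c) p)).

Definition wl_iter (c : colouring) (h : nat) : colouring := iter h wl_step c.

Definition colour_classes (c : colouring) : {set {set T * T}} :=
  preim_partition (paint c) [set: T * T].

Definition wl_stable (c : colouring) (h : nat) : bool :=
  colour_classes (wl_iter c h.+1) == colour_classes (wl_iter c h).

Lemma wl_stable_exists c : exists h, wl_stable c h.
Proof.
pose K h := [set pq : (T * T) * (T * T) |
  paint (wl_iter c h) pq.1 == paint (wl_iter c h) pq.2].
have KS h : K h.+1 \subset K h.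
  apply/subsetP => -[p q]; rewrite !inE /= => /eqP/(congr1 val)/=.
  by rewrite /wl_tuple; case=> ->.
have KE h : K h.+1 = K h -> wl_stable c h.
  move=> eqK; rewrite /wl_stable /colour_classes /preim_partition.
  rewrite /equivalence_partition; apply/eqP.
  apply: eq_imset => p; apply/setP => q; rewrite !inE.
  by have /setP/(_ (p, q)) := eqK; rewrite !inE.
have [/existsP[h Hh]|/existsPn noK] :=
  boolP [exists h : 'I_#|K 0|.+1, wl_stable c h]; first by exists h.
have lt h : h <= #|K 0|.+1 -> #|K h| + h <= #|K 0|.
  elim: h => [|h IH] hle; first by rewrite addn0.
  rewrite addnS -addSn; apply: leq_trans (IH (ltnW hle)); rewrite leq_add2r.
  apply: proper_card; rewrite properEneq KS andbT.
  by apply: contra (noK (Ordinal hle)) => /eqP/KE.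
have := lt _ (leqnn _).
by rewrite addnS ltnNge leq_addl.
Qed.

Definition wl_number (c : colouring) : nat := ex_minn (wl_stable_exists c).

End WeisfeilerLeman.

Definition WL (X : configuration) : nat := wl_number (Colouring (@col X)).

(* As ln 0 = 0, log2 0 = 0; the value at 0 only matters for a diameter 0,
   i.e. for a configuration with at most one vertex. *)
Definition log2 (R : realType) (x : R) : R := (ln x / ln 2)%R.

(* Main.v *)
Require Import Defs.
From mathcomp Require Import all_boot all_order all_algebra.
From mathcomp Require Import reals exp.

Set Implicit Arguments.
Unset Strict Implicit.
Unset Printing Implicit Defensive.

Import Order.TTheory GRing.Theory Num.Theory.

Local Open Scope ring_scope.

(** A step of the algorithm lets the colour of (v, w) see both halves of a walk
    from v to w through its midpoint.  Edges of the colour graph have colours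
    that are partial functions, so after h steps with diam <= 2 ^ h the colour
    of (v, w) and the vertex v determine w.  Two steps later, equality of the
    colours of (v, w) and (v', w') yields a bijection of the vertices that
    maps v to v' and w to w' and preserves the colours at step h, hence the
    initial colours; such an automorphism preserves the colours at every step,
    so step h + 2 is stable. *)

Section Refinement.
Local Open Scope nat_scope.
Variable T : finType.
Implicit Types c : colouring T.

Lemma paint_step_eq c p q :
  paint (wl_step c) p = paint (wl_step c) q -> wl_tuple c p = wl_tuple c q.
Proof. by move/(congr1 val). Qed.

Lemma paint_iter_refines c h k p q :
  paint (wl_iter c (k + h)) p = paint (wl_iter c (k + h)) q ->
  paint (wl_iter c h) p = paint (wl_iter c h) q.
Proof.
by elim: k => [|k IHk] // /paint_step_eq[eq_pq _]; apply: IHk eq_pq.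
Qed.

(** The vertex [z] is itself among the midpoints counted for its pair of colours, so that count is
    positive for both pairs of endpoints. *)
Lemma wl_step_witness c v w v' w' z :
    paint (wl_step c) (v, w) = paint (wl_step c) (v', w') ->
  exists2 z', paint c (v, z) = paint c (v', z')
            & paint c (z, w) = paint c (z', w').
Proof.
move/paint_step_eq=> [_ /ffunP/(_ (paint c (v, z), paint c (z, w)))].
rewrite !ffunE /= => eq_card.
have: 0 < #|[set x | (paint c (v, x) == paint c (v, z)) &&
                     (paint c (x, w) == paint c (z, w))]|.
  by apply/card_gt0P; exists z; rewrite inE !eqxx.
rewrite eq_card => /card_gt0P[z']; rewrite inE => /andP[/eqP vz' /eqP z'w].
by exists z'.
Qed.

(** For each pair of colours, [f] maps the midpoints counted for [(x, y)] onto those counted for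
    [(f x, f y)]. *)
Lemma wl_step_auto c (f : T -> T) : bijective f ->
  (forall x y, paint c (f x, f y) = paint c (x, y)) ->
  forall x y, paint (wl_step c) (f x, f y) = paint (wl_step c) (x, y).
Proof.
move=> bij_f fc x y; apply: val_inj; rewrite /= /wl_tuple fc; congr pair.
apply/ffunP => q; rewrite !ffunE /= -[RHS](card_imset _ (bij_inj bij_f)).
apply: eq_card => z; rewrite inE.
have [g fK gK] := bij_f; rewrite -[z]gK !fc mem_imset ?inE //.
exact: can_inj fK.
Qed.

Lemma wl_iter_auto c (f : T -> T) h : bijective f ->
  (forall x y, paint c (f x, f y) = paint c (x, y)) ->
  forall x y, paint (wl_iter c h) (f x, f y) = paint (wl_iter c h) (x, y).
Proof. by move=> bij_f fc; elim: h => //= h; apply: wl_step_auto. Qed.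

Lemma wl_stableI c h :
  (forall p q, paint (wl_iter c h) p = paint (wl_iter c h) q ->
               paint (wl_iter c h.+1) p = paint (wl_iter c h.+1) q) ->
  wl_stable c h.
Proof.
move=> refine; rewrite /wl_stable /colour_classes /preim_partition.
rewrite /equivalence_partition; apply/eqP.
apply: eq_imset => p; apply/setP => q; rewrite !inE.
apply/eqP/eqP; last exact: refine.
exact: (@paint_iter_refines c h 1).
Qed.

Lemma wl_number_le c h : wl_stable c h -> wl_number c <= h.
Proof. by move=> st; rewrite /wl_number; case: ex_minnP => n _; apply. Qed.

Definition separates_targets c :=
  forall v w w', paint c (v, w) = paint c (v, w') -> w = w'.

Definition separates_diagonal c :=
  forall v w w', paint c (v, v) = paint c (w, w') -> w = w'.

Lemma wl_stable_separated c h : separates_diagonal c ->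
  separates_targets (wl_iter c h) -> wl_stable c h.+2.
Proof.
move=> diag sep; apply: wl_stableI => -[v w] [v' w'] eqh2.
have diag_h x y y' :
    paint (wl_iter c h) (x, x) = paint (wl_iter c h) (y, y') -> y = y'.
  by rewrite -[h]addn0 => /paint_iter_refines/diag.
(* Colours are matched at step [h.+1], so that one more descent to step [h] remains for [f_auto]. *)
have /fin_all_exists[f fP] : forall z, exists z',
    paint (wl_iter c h.+1) (v, z) = paint (wl_iter c h.+1) (v', z') /\
    paint (wl_iter c h.+1) (z, w) = paint (wl_iter c h.+1) (z', w').
  by move=> z; have [z' ? ?] := wl_step_witness z eqh2; exists z'.
have fv z : paint (wl_iter c h) (v, z) = paint (wl_iter c h) (v', f z).
  by have [/(@paint_iter_refines c h 1)] := fP z.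
have f_inj : injective f.
  by move=> x y eq_f; apply: (sep v); rewrite !fv eq_f.
have f_auto x y :
    paint (wl_iter c h) (f x, f y) = paint (wl_iter c h) (x, y).
  (* Seen from [v'], both [x'] and [f x] have the step-[h] colour of [(v, x)], so they coincide. *)
  have [/(wl_step_witness x)[x' vx' x'y] _] := fP y.
  by rewrite x'y; congr (paint _ (_, _)); apply: (sep v'); rewrite -vx' fv.
(* For [z = v] or [z = w], one of the two matched pairs is diagonal, which pins down [f v] and
   [f w]. *)
have <- : f v = v' by symmetry; apply: diag_h (fv v).
have <- : f w = w'.
  by have [_ /(@paint_iter_refines c h 1)] := fP w; apply: diag_h.
rewrite (@wl_iter_auto _ f) //; first exact: injF_bij.
by move=> x y; apply: (@paint_iter_refines c 0 h); rewrite addn0 f_auto.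
Qed.

End Refinement.

Section Distance.
Local Open Scope nat_scope.
Variables (T : finType) (e : rel T) (econ : strongly_connected e).

Lemma dist_walk v w : walk_length e v w (dist econ v w).
Proof. by rewrite /dist; case: ex_minnP. Qed.

Lemma dist_le_diam v w : dist econ v w <= diam econ.
Proof.
apply: leq_trans (leq_bigmax v).
exact: (leq_bigmax (F := fun w => dist econ v w)).
Qed.

End Distance.

Section ColourGraphRefinement.
Local Open Scope nat_scope.
Variable X : configuration.
Let c := Colouring (@Defs.col X).

Lemma col_separates_diagonal : separates_diagonal c.
Proof.
move=> v w w' /= vw; apply: (@col_diag X (Defs.col (v, v))) => //.
by exists v.
Qed.

Lemma colour_graph_functional v w w' :
  @colour_graph X v w -> Defs.col (v, w) = Defs.col (v, w') -> w = w'.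
Proof.
case/andP=> _ /forallP/(_ v)/card_le1_eqP uniq_w eq_col.
by apply: uniq_w; rewrite inE ?eq_col.
Qed.

Lemma walk_separates h v w w' p :
    path (@colour_graph X) v p -> last v p = w -> size p <= 2 ^ h ->
  paint (wl_iter c h) (v, w) = paint (wl_iter c h) (v, w') -> w = w'.
Proof.
elim: h v w w' p => [|h IHh] v w w' p.
  (* Since [2 ^ 0 = 1], the walk is empty or a single edge. *)
  case: p => [|x [|y p]] //=.
    by move=> _ <- _; apply: col_separates_diagonal.
  by rewrite andbT => vx <- _; apply: colour_graph_functional.
rewrite -{1 2}(cat_take_drop (2 ^ h) p) cat_path last_cat.
set z := last v _ => /andP[vz zw] last_w le_p.
have sz_l : size (take (2 ^ h) p) <= 2 ^ h by rewrite size_take_min geq_minl.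
have sz_r : size (drop (2 ^ h) p) <= 2 ^ h.
  by rewrite size_drop leq_subLR addnn -mul2n -expnS.
(* The first half of the walk forces the matching midpoint to be [z]; the second half then forces
   [w'] to be [w]. *)
case/(wl_step_witness z) => z' /(IHh _ _ _ _ vz erefl sz_l) <-.
exact: IHh zw last_w sz_r.
Qed.

Lemma WL_le_up_log (Xcon : strongly_connected (@colour_graph X)) :
  WL X <= up_log 2 (diam Xcon) + 2.
Proof.
rewrite addn2; apply: wl_number_le; apply: wl_stable_separated.
  exact: col_separates_diagonal.
move=> v w w'; have /existsP[p /andP[vp /eqP last_p]] := dist_walk Xcon v w.
apply: walk_separates vp last_p _; rewrite size_tuple.
exact: leq_trans (dist_le_diam Xcon v w) (up_logP _ _).
Qed.

End ColourGraphRefinement.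

Section Log2.
Variable R : realType.

Lemma log2_ge0 (n : nat) : 0 <= log2 n%:R :> R.
Proof.
rewrite /log2; case: n => [|n]; first by rewrite ln0 // mul0r.
by rewrite divr_ge0 ?ln_ge0 // ler1n.
Qed.

Lemma up_log_le_log2 (n : nat) : (up_log 2 n)%:R <= log2 n%:R + 1 :> R.
Proof.
have [le_n1 | lt1n] := leqP n 1.
  (* This covers [n = 0], where [log2] takes the default value 0. *)
  have -> : up_log 2 n = 0%N by case: n le_n1 => [|[]].
  by rewrite addr_ge0 ?log2_ge0.
have ln2_gt0 : 0 < ln 2 :> R by rewrite ln_gt0 // ltr1n.
(* The bound used is [2 ^ (up_log 2 n).-1 < n]. *)
have /andP[lt_n _] := @up_log_bounds 2 n isT lt1n.
have k_gt0 : (0 < up_log 2 n)%N by rewrite up_log_gt0.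
rewrite -(prednK k_gt0) -natr1 lerD2r /log2 ler_pdivlMr //.
rewrite mulr_natl -lnXn // -natrX ler_ln ?posrE ?ltr0n ?expn_gt0 //.
  by rewrite ler_nat ltnW.
exact: ltnW.
Qed.

End Log2.

Theorem theorem4 (R : realType) (X : configuration)
    (Xcon : strongly_connected (@colour_graph X)) :
  (WL X)%:R <= log2 (diam Xcon)%:R + 3 :> R.
Proof.
have := WL_le_up_log Xcon; rewrite -(ler_nat R) natrD => /le_trans; apply.
(* The 1 pays for rounding the logarithm up, the 2 for the steps after targets are separated. *)
have -> : 3 = 1 + 2 :> R by rewrite -(natrD R 1 2).
by rewrite [leRHS]addrA lerD2r up_log_le_log2.
Qed.
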